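(* Let $\mathbf{A}$ be an algebra in a congruence modular variety such that $\mathbf{A}$ has only finitely many congruences. Then there is a finite set $\Phi$ of commutator equalities over the congruence lattice $\mathrm{Con}(\mathbf{A})$ such that the sequence of higher commutator operations of $\mathbf{A}$ is the largest operation sequence on $\mathrm{Con}(\mathbf{A})$ among those that satisfy (HC3), (HC4) and all equalities in $\Phi$.
   Context: $\mathbb{N}=\{1,2,\dots\}$. An operation sequence on a lattice $\mathbb{L}$ is a sequence $(f_n)_{n\in\mathbb{N}}$ with $f_n:\mathbb{L}^n\to\mathbb{L}$ for each $n$. Operation sequences are ordered pointwise: $(f_n)\le(g_n)$ iff $f_n(\alpha_1,\dots,\alpha_n)\le g_n(\alpha_1,\dots,\alpha_n)$ for all $n$ and all arguments. We also write $[\alpha_1,\dots,\alpha_n]_f$ for $f_n(\alpha_1,\dots,\alpha_n)$. (HC3), omission property: $f_{n+1}(\alpha_1,\dots,\alpha_{n+1})\le f_n(\alpha_2,\dots,\alpha_{n+1})$ for all $n\in\mathbb{N}$ and all $\alpha_1,\dots,\alpha_{n+1}\in\mathbb{L}$. (HC4), symmetry: $f_n(\alpha_1,\dots,\alpha_n)=f_n(\alpha_{\sigma(1)},\dots,\alpha_{\sigma(n)})$ for all $n\in\mathbb{N}$, all $\alpha_1,\dots,\alpha_n\in\mathbb{L}$ and all permutations $\sigma\in S_n$. A commutator equality over $\mathbb{L}$ is a formula $[\alpha_1,\dots,\alpha_n]=\beta$ with $n\in\mathbb{N}$ and $\alpha_1,\dots,\alpha_n,\beta\in\mathbb{L}$;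 the sequence $(f_n)$ satisfies it if $f_n(\alpha_1,\dots,\alpha_n)=\beta$. Higher commutators (Bulatov): for an algebra $\mathbf{A}$ with universe $A$ and congruences $\alpha_1,\dots,\alpha_n,\delta$, say that $\alpha_1,\dots,\alpha_{n-1}$ centralize $\alpha_n$ modulo $\delta$ if for all $k_1,\dots,k_n\in\mathbb{N}_0$, all tuples $\mathbf{a}_i,\mathbf{b}_i\in A^{k_i}$ that are componentwise congruent modulo $\alpha_i$ ($i=1,\dots,n$), and every polynomial operation $p$ of $\mathbf{A}$ of arity $k_1+\dots+k_n$: if $p(\mathbf{x}_1,\dots,\mathbf{x}_{n-1},\mathbf{a}_n)\equiv_\delta p(\mathbf{x}_1,\dots,\mathbf{x}_{n-1},\mathbf{b}_n)$ for all $(\mathbf{x}_1,\dots,\mathbf{x}_{n-1})\in\big(\prod_{i=1}^{n-1}\{\mathbf{a}_i,\mathbf{b}_i\}\big)\setminus\{(\mathbf{b}_1,\dots,\mathbf{b}_{n-1})\}$, then $p(\mathbf{b}_1,\dots,\mathbf{b}_{n-1},\mathbf{a}_n)\equiv_\delta p(\mathbf{b}_1,\dots,\mathbf{b}_{n-1},\mathbf{b}_n)$. The higher commutator $[\alpha_1,\dots,\alpha_n]_{\mathbf{A}}$ is the smallest congruence $\delta$ such that $\alpha_1,\dots,\alpha_{n-1}$ centralize $\alpha_n$ modulo $\delta$ (for $n=1$ this gives $[\alpha]_{\mathbf{A}}=\alpha$). The sequence of higher commutator operations of $\mathbf{A}$ is the operation sequence on $\mathrm{Con}(\mathbf{A})$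 given by $f_n(\alpha_1,\dots,\alpha_n)=[\alpha_1,\dots,\alpha_n]_{\mathbf{A}}$.
   Formalization: In the definition of ''centralize'', the choices of x_i from {a_i, b_i} are counted formally, so only the all-b choice is removed even if some a_i = b_i; read literally as tuples, the premise becomes empty then, giving [α_1,α_2]=α_2 and contradicting (HC4). *)

(* Defs.v *)
From HB Require Import structures.
From mathcomp Require Import all_boot all_order perm.
From mathcomp Require Import boolp classical_sets cardinality.
Set Implicit Arguments.
Unset Strict Implicit.
Unset Printing Implicit Defensive.

Import Order.TTheory.
Local Open Scope order_scope.

(* In [opseq], [hcomm] and [comm_eq], the index n stands for arity n.+1, so
   that n : nat ranges over the arities 1, 2, 3, ... *)

Section OperationSequences.
Context {disp : Order.disp_t} {L : latticeType disp}.

Definition opseq : Type := forall n : nat, n.+1.-tuple L -> L.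

Definition opseq_le (f g : opseq) : Prop :=
  forall (n : nat) (a : n.+1.-tuple L), f n a <= g n a.

Definition HC3 (f : opseq) : Prop :=
  forall (n : nat) (a : L) (t : n.+1.-tuple L), f n.+1 (cons_tuple a t) <= f n t.

Definition HC4 (f : opseq) : Prop :=
  forall (n : nat) (t : n.+1.-tuple L) (s : 'S_n.+1),
    f n t = f n [tuple tnth t (s i) | i < n.+1].

Record comm_eq : Type := CommEq {
  ce_len : nat;
  ce_args : ce_len.+1.-tuple L;
  ce_val : L }.

Definition satisfies (f : opseq) (e : comm_eq) : Prop :=
  f (ce_len e) (ce_args e) = ce_val e.

Definition is_largest (Q : opseq -> Prop) (f : opseq) : Prop :=
  Q f /\ forall g : opseq, Q g -> opseq_le g f.

Definition modular_lattice : Prop :=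
  forall x y z : L, x <= z -> x `|` (y `&` z) = (x `|` y) `&` z.

End OperationSequences.

Arguments opseq {disp} L.
Arguments comm_eq {disp} L.
Arguments modular_lattice {disp} L.

Record signature : Type := Signature {
  op_symbol : Type;
  arity : op_symbol -> nat }.

Record algebra (S : signature) : Type := Algebra {
  carrier :> Type;
  interp : forall o : op_symbol S, (arity o).-tuple carrier -> carrier }.

Section Varieties.
Context {S : signature}.

Definition is_hom (A B : algebra S) (h : A -> B) : Prop :=
  forall (o : op_symbol S) (t : (arity o).-tuple A),
    h (interp t) = interp (map_tuple h t).

Definition op_closed (A : algebra S) (P : A -> Prop) : Prop :=
  forall (o : op_symbol S) (t : (arity o).-tuple A),
    (forall i, P (tnth t i)) -> P (interp t).

Lemma sub_interp_closed (A : algebra S) (P : A -> Prop) (hP : op_closed P)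
    (o : op_symbol S) (t : (arity o).-tuple {x : A | P x}) :
  P (interp (map_tuple sval t)).
Proof. by apply: hP => i; rewrite tnth_map; exact: svalP. Qed.

Definition subalgebra (A : algebra S) (P : A -> Prop) (hP : op_closed P) :
    algebra S :=
  {| carrier := {x : A | P x};
     interp := fun o t => exist P _ (sub_interp_closed hP t) |}.

Definition prod_algebra (I : Type) (B : I -> algebra S) : algebra S :=
  {| carrier := forall i : I, B i;
     interp := fun o t i => interp (map_tuple (fun x => x i) t) |}.

Definition is_variety (V : algebra S -> Prop) : Prop :=
  [/\ forall (A B : algebra S) (h : A -> B),
        is_hom h -> (forall b, exists a, h a = b) -> V A -> V B,
      forall (A : algebra S) (P : A -> Prop) (hP : op_closed P),
        V A -> V (subalgebra hP)
    & forall (I : Type) (B : I -> algebra S),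
        (forall i, V (B i)) -> V (prod_algebra B)].

End Varieties.

Record con (S : signature) (A : algebra S) : Type := Con {
  con_rel :> A -> A -> Prop;
  con_refl : forall a, con_rel a a;
  con_sym : forall a b, con_rel a b -> con_rel b a;
  con_trans : forall a b c, con_rel a b -> con_rel b c -> con_rel a c;
  con_op : forall (o : op_symbol S) (s t : (arity o).-tuple A),
    (forall i, con_rel (tnth s i) (tnth t i)) -> con_rel (interp s) (interp t) }.

Fact con_display : Order.disp_t. Proof. exact: Order.Disp tt tt. Qed.

Section CongruenceLattice.
Context {S : signature} {A : algebra S}.
Implicit Types x y z : con A.

Lemma con_ext x y : (forall a b, x a b <-> y a b) -> x = y.
Proof.
case: x y => [r r1 r2 r3 r4] [s s1 s2 s3 s4] /= rs.
have e : r = s by apply/funext => a; apply/funext => b; exact/propext.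
by subst s; congr Con; exact: Prop_irrelevance.
Qed.

HB.instance Definition _ := gen_eqMixin (con A).
HB.instance Definition _ := gen_choiceMixin (con A).

Definition con_le x y : bool := `[< forall a b, x a b -> y a b >].

Lemma con_le_refl : reflexive con_le.
Proof. by move=> x; apply/asboolP. Qed.

Lemma con_le_anti : antisymmetric con_le.
Proof.
move=> x y /andP[/asboolP xy /asboolP yx]; apply: con_ext => a b.
by split; [exact: xy | exact: yx].
Qed.

Lemma con_le_trans : transitive con_le.
Proof.
by move=> y x z /asboolP xy /asboolP yz; apply/asboolP => a b /xy; exact: yz.
Qed.

HB.instance Definition _ := Order.Le_isPOrder.Build con_display (con A)
  con_le_refl con_le_anti con_le_trans.

Lemma con_leP x y : reflect (forall a b, x a b -> y a b) (x <= y).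
Proof. exact: asboolP. Qed.

(* The intersection of the congruences in P (the full relation if there are
   none). *)
Definition con_inf (P : con A -> Prop) : con A.
Proof.
refine (@Con S A (fun a b => forall d, P d -> d a b) _ _ _ _).
- by move=> a d _; exact: con_refl.
- by move=> a b ab d Pd; apply/con_sym/ab.
- by move=> a b c ab bc d Pd; apply: con_trans (ab _ Pd) (bc _ Pd).
- by move=> o s t st d Pd; apply: con_op => i; exact: st.
Defined.

Lemma con_inf_lb (P : con A -> Prop) x : P x -> con_inf P <= x.
Proof. by move=> Px; apply/con_leP => a b; exact. Qed.

Lemma con_inf_glb (P : con A -> Prop) x :
  (forall y, P y -> x <= y) -> x <= con_inf P.
Proof. by move=> xP; apply/con_leP => a b xab d /xP/con_leP; exact. Qed.

Definition con_meet x y : con A := con_inf (fun d => d = x \/ d = y).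
Definition con_join x y : con A := con_inf (fun d => x <= d /\ y <= d).

Lemma con_meetP x y z : (x <= con_meet y z) = (x <= y) && (x <= z).
Proof.
apply/idP/andP => [xm | [xy xz]]; last by apply: con_inf_glb => d [] ->.
by split; apply: le_trans xm _; apply: con_inf_lb; [left | right].
Qed.

Lemma con_joinP x y z : (con_join x y <= z) = (x <= z) && (y <= z).
Proof.
apply/idP/andP => [jz | xyz]; last exact: con_inf_lb.
by split; apply: le_trans jz; apply: con_inf_glb => d [].
Qed.

HB.instance Definition _ :=
  Order.POrder_MeetJoin_isLattice.Build con_display (con A)
    con_meetP con_joinP.

End CongruenceLattice.

Definition congruence_modular (S : signature) (V : algebra S -> Prop) : Prop :=
  forall B : algebra S, V B -> modular_lattice (con B).

Section HigherCommutators.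
Context {S : signature} {A : algebra S}.

Inductive polynomial (k : nat) : (k.-tuple A -> A) -> Prop :=
| poly_proj (i : 'I_k) : polynomial (fun x => tnth x i)
| poly_const (c : A) : polynomial (fun _ => c)
| poly_op (o : op_symbol S) (g : 'I_(arity o) -> k.-tuple A -> A) :
    (forall i, polynomial (g i)) ->
    polynomial (fun x => interp [tuple g i x | i < arity o]).

(* The concatenation of the blocks x_0, ..., x_(m-1): [tagnat.sig1 j] is the
   block in which position j falls and [tagnat.sig2 j] its place there. *)
Definition concat (m : nat) (k : 'I_m -> nat) (x : forall i, (k i).-tuple A) :
    (\sum_(i < m) k i)%N.-tuple A :=
  [tuple tnth (x (tagnat.sig1 j)) (tagnat.sig2 j) | j < (\sum_(i < m) k i)%N].

Definition mix (m : nat) (k : 'I_m -> nat) (a b : forall i, (k i).-tuple A)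
    (s : {set 'I_m}) : forall i, (k i).-tuple A :=
  fun i => if i \in s then b i else a i.

(* The blocks taken from b, among the first n, are recorded by a set s of
   indices; the excluded choice is s = ~: [set ord_max].  Choices are formal:
   they are told apart by s even if a i = b i for some i.  Comparing the tuples
   themselves would empty the premise as soon as a i = b i for some i < n. *)
Definition centralizes (n : nat) (alpha : n.+1.-tuple (con A)) (delta : con A) :
    Prop :=
  forall (k : 'I_n.+1 -> nat) (a b : forall i, (k i).-tuple A)
    (p : (\sum_(i < n.+1) k i)%N.-tuple A -> A),
    (forall i (j : 'I_(k i)), tnth alpha i (tnth (a i) j) (tnth (b i) j)) ->
    polynomial p ->
    (forall s : {set 'I_n.+1}, s \proper ~: [set ord_max]%SET ->
       delta (p (concat (mix a b s))) (p (concat (mix a b (ord_max |: s))))) ->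
    delta (p (concat (mix a b (~: [set ord_max]%SET)))) (p (concat b)).

Definition hcomm : opseq (con A) :=
  fun n alpha => con_inf (@centralizes n alpha).

Lemma hcomm_centralizes n (alpha : n.+1.-tuple (con A)) :
  centralizes alpha (hcomm alpha).
Proof.
move=> k a b p ab pp H d dc; apply: (dc k a b p ab pp) => s hs.
exact: H hs d dc.
Qed.

Lemma hcomm_least n (alpha : n.+1.-tuple (con A)) (delta : con A) :
  centralizes alpha delta -> hcomm alpha <= delta.
Proof. exact: con_inf_lb. Qed.

End HigherCommutators.

Arguments hcomm {S} A.

(* Main.v *)
(* The higher commutators satisfy (HC3) in any algebra.  For (HC4) one has to
   see that the term condition does not depend on which coordinate plays the
   last role.  This follows from one use of the modular law in the congruence
   lattice of a subalgebra of A^(2^n), whose elements are the cubes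
   s |-> p(x_s), s a set of coordinates, obtained from a polynomial p; no Day
   terms are needed.
   By Dickson's lemma, finitely many values then determine the largest operation
   sequence: (HC4) turns arguments into multisets, (HC3) makes the sequence
   antitone in the multiset, and for each of the finitely many values, the
   multisets where it is attained have only finitely many minimal elements. *)
Require Import Defs.
From mathcomp Require Import all_boot all_order perm.
From mathcomp Require Import boolp classical_sets cardinality.
Set Implicit Arguments.
Unset Strict Implicit.
Unset Printing Implicit Defensive.

Import Order.TTheory.

(** * Joins of congruences *)

Lemma con_join_preserves (S : signature) (A : algebra S) (x y : con A)
    (P : A -> Prop) :
  (forall u v, x u v \/ y u v -> P u -> P v) ->
  forall u v, con_join x y u v -> P u -> P v.
Proof.
move=> Pstep u v.
(* [J u v] says that [v] lies in every set that contains [u] and is closed under [x]- and [y]-steps.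
   It is a congruence above [x] and [y], so it contains their join; no explicit chains are
   needed. *)
pose J u v := forall Q : A -> Prop,
  (forall u v, x u v \/ y u v -> Q u -> Q v) -> Q u -> Q v.
have J_refl a : J a a by move=> Q _.
have J_sym a b : J a b -> J b a.
  move=> ab Q Qstep Qb; apply: (ab (fun w => Q w -> Q a)) Qb => //.
  move=> c d cd QcQa Qd.
  by apply: QcQa; apply: (Qstep d) => //; case: cd => /con_sym; [left | right].
have J_trans a b c : J a b -> J b c -> J a c.
  by move=> ab bc Q Qstep /ab-/(_ Qstep)/bc; exact.
(* Replace the arguments one at a time. *)
have J_op (o : op_symbol S) (s t : (arity o).-tuple A) :
    (forall i, J (tnth s i) (tnth t i)) -> J (interp s) (interp t).
  move=> st Q Qstep Qs.
  pose w n := [tuple if i < n then tnth t i else tnth s i | i < arity o].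
  suff Qw n : n <= arity o -> Q (interp (w n)).
    suff <- : w (arity o) = t by exact: Qw.
    by apply: eq_from_tnth => i; rewrite tnth_mktuple ltn_ord.
  elim: n => [_|n IHn n_lt].
    by suff -> : w 0 = s by []; apply: eq_from_tnth => i; rewrite tnth_mktuple.
  pose i0 := Ordinal n_lt.
  pose z a := [tuple if i == i0 then a else tnth (w n) i | i < arity o].
  have -> : w n.+1 = z (tnth t i0).
    apply: eq_from_tnth => i; rewrite !tnth_mktuple.
    case: eqVneq => [->|]; rewrite ltnS leq_eqVlt ?eqxx // -val_eqE.
    by move=> /negPf->.
  apply: (st i0 (fun a => Q (interp (z a)))); last first.
    suff -> : z (tnth s i0) = w n by exact: IHn (ltnW n_lt).
    apply: eq_from_tnth => i; rewrite !tnth_mktuple.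
    by case: eqVneq => [->|//]; rewrite ltnn.
  move=> a b ab; apply: Qstep.
  by case: ab => ab; [left | right]; apply: con_op => i; rewrite !tnth_mktuple;
    case: ifP => // _; exact: con_refl.
pose Jc := Con J_refl J_sym J_trans J_op.
move=> /(_ Jc) xyJ; apply: (xyJ _ P Pstep); split; apply/con_leP => a b ab Q Qs;
  by apply: Qs; auto.
Qed.

Lemma proper_setC1 (I : finType) (s : {set I}) j :
  (s \proper [set~ j]%SET) = (j \notin s) && (s != [set~ j]%SET).
Proof. by rewrite finset.properEneq andbC finset.subsetC finset.sub1set inE. Qed.

(** * Cubes and the term condition *)

Section TermCondition.
Context {S : signature} {A : algebra S}.

Lemma polynomial_comp N M (p : N.-tuple A -> A) (g : 'I_N -> M.-tuple A -> A) :
  polynomial p -> (forall i, polynomial (g i)) ->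
  polynomial (fun x => p [tuple g i x | i < N]).
Proof.
move=> pp gp; elim: pp => [i|c|o q _ qp]; last exact: poly_op.
  suff -> : (fun x => tnth [tuple g i x | i < N] i) = g i by [].
  by apply/funext => x; rewrite tnth_mktuple.
exact: poly_const.
Qed.

Section Cube.
Context {I : finType} {N : nat} (c : 'I_N -> I) (x y : 'I_N -> A).

Definition vertex (s : {set I}) : N.-tuple A :=
  [tuple if c i \in s then y i else x i | i < N].

Definition cube (F : {set I} -> A) : Prop :=
  exists2 q : N.-tuple A -> A, polynomial q & forall s, F s = q (vertex s).

Lemma cube_closed : @op_closed S (prod_algebra (fun=> A)) cube.
Proof.
move=> o t /= ct.
have /choice[q qP] : forall i, exists q : N.-tuple A -> A,
    polynomial q /\ forall s, tnth t i s = q (vertex s).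
  by move=> i; have [q qp qE] := ct i; exists q.
exists (fun z => interp [tuple q i z | i < arity o]).
  by apply: poly_op => i; case: (qP i).
move=> s; congr interp; apply: eq_from_tnth => i.
by rewrite tnth_map tnth_mktuple; case: (qP i).
Qed.

(** Arguments belonging to [L] are frozen at [x], then those belonging to [J] at [y]; constants are
    polynomials, so the result is again a cube. *)
Lemma cube_subst (F : {set I} -> A) (J L : {set I}) :
  cube F -> cube (fun s => F ((s :|: J) :\: L)).
Proof.
case=> q qp FE.
pose g (i : 'I_N) (z : N.-tuple A) :=
  if c i \in L then x i else if c i \in J then y i else tnth z i.
exists (fun z => q [tuple g i z | i < N]).
  apply: polynomial_comp => // i; rewrite /g.
  case: (c i \in L); first exact: poly_const.
  case: (c i \in J); [exact: poly_const | exact: poly_proj].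
move=> s; rewrite FE; congr q; apply: eq_from_tnth => i.
rewrite !tnth_mktuple /g !inE.
case: (c i \in L) => //=.
by case: (c i \in J); rewrite ?orbT ?orbF ?tnth_mktuple.
Qed.

Definition cube_algebra : algebra S := subalgebra cube_closed.

Definition agree_on (delta : con A) (W : {set {set I}}) : con cube_algebra.
Proof.
refine (@Con S cube_algebra
  (fun F G => forall s, s \in W -> delta (sval F s) (sval G s)) _ _ _ _).
- by move=> F s _; exact: con_refl.
- by move=> F G FG s sW; apply/con_sym/FG.
- by move=> F G H FG GH s sW; apply: con_trans (FG s sW) (GH s sW).
- move=> o t u tu s sW /=; apply: con_op => i; rewrite !tnth_map; exact: tu.
Defined.

End Cube.

(* Unlike [centralizes], this allows any coordinate j in the last role, and any
   distribution c of the N arguments over the coordinates. *)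
Definition centralizes_at (I : finType) (alpha : I -> con A) (j : I)
    (delta : con A) : Prop :=
  forall N (c : 'I_N -> I) (x y : 'I_N -> A) (p : N.-tuple A -> A),
    (forall i, alpha (c i) (x i) (y i)) -> polynomial p ->
    (forall s : {set I}, j \notin s -> s != [set~ j]%SET ->
       delta (p (vertex c x y s)) (p (vertex c x y (j |: s)%SET))) ->
    delta (p (vertex c x y [set~ j]%SET)) (p (vertex c x y [set: I]%SET)).

(** Blocks are the distribution [tagnat.sig1]. Conversely, each block is a copy of all [N]
    positions, where [b] differs from [a] at most at those with [c i == e], and [q] reads position
    [i] in block [c i]. *)
Lemma centralizesE n (alpha : n.+1.-tuple (con A)) delta :
  centralizes alpha delta <-> centralizes_at (tnth alpha) ord_max delta.
Proof.
split=> [cent N c x y p xy pp H|cent k a b p ab pp H].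
  pose k := fun _ : 'I_n.+1 => N.
  pose a (e : 'I_n.+1) : (k e).-tuple A := [tuple x i | i < N].
  pose b (e : 'I_n.+1) : (k e).-tuple A :=
    [tuple if c i == e then y i else x i | i < N].
  pose q (z : (\sum_(e < n.+1) k e)%N.-tuple A) :=
    p [tuple tnth z (tagnat.Rank (c i) (i : 'I_(k (c i)))) | i < N].
  have qE s : q (concat (mix a b s)) = p (vertex c x y s).
    have mixE e (i : 'I_N) :
        tnth (mix a b s e) i = if (e \in s) && (c i == e) then y i else x i.
      by rewrite /mix; case: (e \in s); rewrite tnth_mktuple.
    congr p; apply: eq_from_tnth => i; rewrite !tnth_mktuple mixE.
    have -> : tagnat.sig2 (tagnat.Rank (c i) (i : 'I_(k (c i)))) = i.
      by apply: val_inj; rewrite /= tagnat.Rank2K.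
    by rewrite tagnat.Rank1K eqxx andbT.
  have bE : b = mix a b [set: 'I_n.+1]%SET.
    by apply: functional_extensionality_dep => e; rewrite /mix inE.
  rewrite -!qE -bE; apply: cent.
  - move=> e i; rewrite !tnth_mktuple; case: eqVneq => [<-|_]; first exact: xy.
    exact: con_refl.
  - apply: polynomial_comp => // i; exact: poly_proj.
  - move=> s; rewrite proper_setC1 !qE => /andP[]; exact: H.
have vE s : concat (mix a b s) =
    vertex (@tagnat.sig1 _ k)
      (fun j => tnth (a (tagnat.sig1 j)) (tagnat.sig2 j))
      (fun j => tnth (b (tagnat.sig1 j)) (tagnat.sig2 j)) s.
  by apply: eq_from_tnth => j; rewrite !tnth_mktuple /mix; case: ifP.
have -> : concat b = concat (mix a b [set: 'I_n.+1]%SET).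
  by congr concat; apply: functional_extensionality_dep => i; rewrite /mix inE.
rewrite !vE; apply: cent => // s js sj; rewrite -!vE; apply: H.
by rewrite proper_setC1 js.
Qed.

(** Coordinates outside the image of [h] are frozen at [y], because both vertices in the conclusion
    contain them; [T s] is the vertex obtained from [s] in this way. *)
Lemma centralizes_at_inj (I J : finType) (h : I -> J) (alpha : J -> con A) j
    delta :
  injective h -> centralizes_at (alpha \o h) j delta ->
  centralizes_at alpha (h j) delta.
Proof.
move=> h_inj cent N c x y p xy pp H.
(* The default [j] is harmless: where it is used, [x'] and [y] coincide. *)
pose h' e := odflt j [pick i | h i == e].
have hK i : h' (h i) = i.
  by rewrite /h'; case: pickP => [i' /eqP/h_inj//|/(_ i)]; rewrite eqxx.
pose out e := e \notin codom h.
have h'K e : ~~ out e -> h (h' e) = e.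
  by rewrite negbK => /codomP[i ->]; rewrite hK.
pose x' i := if out (c i) then y i else x i.
pose T (s : {set I}) := [set e | out e || (h' e \in s)]%SET.
have vE s : vertex (h' \o c) x' y s = vertex c x y (T s).
  apply: eq_from_tnth => i; rewrite !tnth_mktuple /x' inE /=.
  by case: (out _) => //=; case: ifP.
have out_h i : out (h i) = false by rewrite /out codom_f.
have TC : T [set~ j]%SET = [set~ h j]%SET.
  apply/setP => e; rewrite !inE; case: (boolP (out e)) => [oe|/h'K ee] /=.
    by apply/esym/eqP => ee; rewrite ee out_h in oe.
  by rewrite -(inj_eq h_inj) ee.
have TT : T [set: I]%SET = [set: J]%SET by apply/setP => e; rewrite !inE orbT.
have TU s : T (j |: s)%SET = (h j |: T s)%SET.
  apply/setP => e; rewrite !inE; case: (boolP (out e)) => [|/h'K ee] /=.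
    by rewrite orbT.
  by rewrite -(inj_eq h_inj) ee.
rewrite -TC -TT -!vE; apply: cent => // [i /=|s js sj].
  rewrite /x'; case: ifPn => [_|/h'K->//]; exact: con_refl.
rewrite !vE TU; apply: H; rewrite ?inE ?out_h ?hK //.
apply: contra_neq sj => sj; apply/setP => i.
by have /setP/(_ (h i)) := sj; rewrite !inE out_h hK (inj_eq h_inj).
Qed.

(** (HC3) is the case [lift ord0], (HC4) the case of a permutation and its inverse. As [h ord_max]
    may differ from [ord_max], [swap] restores the last role. *)
Lemma hcomm_inj n m (alpha : n.+1.-tuple (con A)) (beta : m.+1.-tuple (con A))
    (h : 'I_n.+1 -> 'I_m.+1) :
  (forall (gamma : 'I_m.+1 -> con A) j l delta,
     centralizes_at gamma j delta -> centralizes_at gamma l delta) ->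
  injective h -> (forall i, tnth alpha i = tnth beta (h i)) ->
  (hcomm A m beta <= hcomm A n alpha)%O.
Proof.
move=> swap h_inj ab; apply/hcomm_least/centralizesE/(swap _ (h ord_max)).
apply: centralizes_at_inj => //.
suff -> : tnth beta \o h = tnth alpha by apply/centralizesE/hcomm_centralizes.
by apply/funext => i /=.
Qed.

End TermCondition.

(** * Symmetry of the term condition from modularity *)

Section Modular.
Context {S : signature} {V : algebra S -> Prop} {A : algebra S}.
Hypotheses (V_variety : is_variety V) (V_modular : congruence_modular V).
Hypothesis VA : V A.

(* With F the cube of the term condition, let X, Y, Z = F and U be the cubes
   s |-> F ((s + j) - l), F (s - l), F s and F (s + j).  At the full vertex X and
   Y agree, and so do Z and U; the premise for l says that Y and Z agree modulo
   delta elsewhere, and X and U outside the pivot edge in direction j.  The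
   modular law thus joins X to U by steps that agree either off the full vertex,
   or off the other end of that edge; along these steps, closeness to X is
   preserved by the term condition for j. *)
Lemma centralizes_at_swap (I : finType) (alpha : I -> con A) (j l : I) delta :
  centralizes_at alpha j delta -> centralizes_at alpha l delta.
Proof.
have [->//|jl] := eqVneq j l.
move=> cent N c x y p xy pp H.
pose F s := p (vertex c x y s).
have cF : cube c x y F by exists p.
set B := cube_algebra c x y.
have modB : modular_lattice (con B).
  by case: V_variety => _ Vsub Vprod; apply/V_modular/Vsub/Vprod.
pose sub J L : B := exist _ _ (cube_subst J L cF).
pose X := sub [set j]%SET [set l]%SET.
pose Y := sub finset.set0 [set l]%SET.
pose Z := sub finset.set0 finset.set0.
pose U := sub [set j]%SET finset.set0.
pose full := [set: I]%SET.
pose K W : con B := agree_on c x y delta W.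
pose alp := K [set full]%SET.
pose bet := K (~: [set full; [set~ j]])%SET.
pose gam := K (~: [set full])%SET.
have gb : (gam <= bet)%O.
  apply/con_leP => f g fg s; rewrite !inE negb_or => /andP[sf _].
  by apply: fg; rewrite !inE.
have Fl s : s != full -> delta (F (s :\ l)%SET) (F s).
  move=> sf; case: (boolP (l \in s)) => ls; last first.
    have -> : (s :\ l)%SET = s.
      apply/setP => i; rewrite !inE.
      by case: eqVneq => // ->; rewrite (negPf ls).
    exact: con_refl.
  rewrite -{2}(finset.setD1K ls); apply: H; first by rewrite !inE eqxx.
  apply: contra_neq sf => sl; rewrite -(finset.setD1K ls) sl; apply/setP => i.
  by rewrite !inE; case: eqVneq.
have jfull (s : {set I}) : s != full -> s != [set~ j]%SET ->
    (s :|: [set j])%SET != full.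
  move=> sf sj; apply: contraNneq sf => sf; case: (boolP (j \in s)) => js.
    by rewrite -sf; apply/eqP/setP => i; rewrite !inE;
      case: eqVneq => [->|_]; rewrite ?js ?orbF.
  case/eqP: sj; apply/setP => i; move/setP/(_ i): sf; rewrite !inE.
  by case: eqVneq => [->|_]; rewrite ?(negPf js) ?orbF.
(* The path is [X], [Y], [Z], [U], by [alp], [gam], [alp]. *)
have XU : con_meet (con_join gam alp) bet X U.
  move=> d [->|->]; last first.
    move=> s.
    rewrite !inE negb_or => /andP[sf sj] /=.
    by rewrite finset.setD0; apply/Fl/jfull.
  move=> {}d [/con_leP gd /con_leP ad].
  apply: (@con_trans _ _ _ _ Y).
    apply: ad => s; rewrite inE => /eqP -> /=.
    by rewrite !finset.setTU; exact: con_refl.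
  apply: (@con_trans _ _ _ _ Z).
    apply: gd => s; rewrite !inE => sf /=.
    by rewrite finset.setU0 finset.setD0; exact: Fl.
  apply: ad => s; rewrite inE => /eqP -> /=.
  by rewrite !finset.setTU; exact: con_refl.
have mod_eq :
    con_join gam (con_meet alp bet) = con_meet (con_join gam alp) bet.
  exact: modB.
rewrite -mod_eq in XU.
pose P (G : B) := forall s, s != full -> delta (sval G s) (sval X s).
(* [X] is constant along edges in direction [j], so a cube close to [X] off the pivot edge satisfies
   the premise of [cent]. *)
have pivot (G : B) : (forall s, s \notin [set full; [set~ j]]%SET ->
      delta (sval G s) (sval X s)) ->
    delta (sval G [set~ j]%SET) (sval G full).
  case: G => G [q qp GE] /= GX; rewrite !GE; apply: cent => // s js sj.
  rewrite -!GE.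
  have sf : s != full by apply: contraNneq js => ->; rewrite inE.
  apply: (@con_trans _ _ _ _ (F ((s :|: [set j]) :\ l)%SET)).
    by apply: GX; rewrite !inE negb_or sf.
  have -> : (s :|: [set j] = (j |: s) :|: [set j])%SET.
    by apply/setP => i; rewrite !inE; case: eqVneq; rewrite ?orbT ?orbF.
  apply/con_sym/GX; rewrite !inE negb_or finset.setUC jfull //.
  by apply/eqP => /setP/(_ j); rewrite !inE eqxx orbT.
have : P U.
  apply: (@con_join_preserves _ _ _ _ P _ _ _ XU); last first.
    by move=> s _; exact: con_refl.
  move=> G G' [GG' PG s sf|GG' PG].
    by apply: con_trans (PG s sf); apply/con_sym/GG'; rewrite !inE.
  have aGG' : alp G G' by apply: GG'; left.
  have bGG' : bet G G' by apply: GG'; right.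
  have PbG' s : s \notin [set full; [set~ j]]%SET ->
      delta (sval G' s) (sval X s).
    move=> sP; apply: con_trans (PG s _); last first.
      by apply: contraNneq sP => ->; rewrite !inE eqxx.
    by apply/con_sym/bGG'; rewrite inE.
  move=> s sf; case: (eqVneq s [set~ j]%SET) => [->|sj]; last first.
    by apply: PbG'; rewrite !inE negb_or sf.
  (* The detour at [[set~ j]]: from [G'] along the pivot edge to [full], over to [G] by [alp], and
     back along the edge to [[set~ j]], where [PG] applies. *)
  apply: con_trans (pivot _ PbG') _.
  apply: (@con_trans _ _ _ _ (sval G full)).
    by apply/con_sym/aGG'; rewrite inE.
  apply: con_trans (PG _ _); last first.
    by apply/eqP => /setP/(_ j); rewrite !inE eqxx.
  apply/con_sym/pivot => s' s'P; apply: PG.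
  by apply: contraNneq s'P => ->; rewrite !inE eqxx.
(* At [[set~ j]] the value of [U] is [F full] and that of [X] is [F [set~ l]]: the conclusion for
   [l]. *)
move=> /(_ [set~ j]%SET) /= PU.
have jT : ([set~ j] :|: [set j] = full)%SET.
  by apply/setP => i; rewrite !inE orNb.
rewrite jT finset.setD0 finset.setTD in PU; apply/con_sym/PU.
by apply/eqP => /setP/(_ j); rewrite !inE eqxx.
Qed.

Lemma hcomm_HC3 : HC3 (hcomm A).
Proof.
move=> n a t; apply: (@hcomm_inj _ _ _ _ _ _ (lift ord0)).
- exact: centralizes_at_swap.
- exact: lift_inj.
- by move=> i; rewrite tnthS.
Qed.

Lemma hcomm_HC4 : HC4 (hcomm A).
Proof.
move=> n t s; apply: le_anti; apply/andP; split.
  apply: (@hcomm_inj _ _ _ _ _ _ s); first exact: centralizes_at_swap.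
    exact: perm_inj.
  by move=> i; rewrite tnth_mktuple.
apply: (@hcomm_inj _ _ _ _ _ _ (perm_inv s)); first exact: centralizes_at_swap.
  exact: perm_inj.
by move=> i; rewrite tnth_mktuple permKV.
Qed.

End Modular.

(* Dickson's lemma, for the tuples (f v) with f ranging over fs. *)
Lemma dickson (T : eqType) (fs : seq (T -> nat)) (U : T -> Prop) :
  exists2 s : seq T, (forall v, v \in s -> U v) &
    forall u, U u -> exists2 v, v \in s & forall i, i < size fs ->
      nth (fun=> 0) fs i v <= nth (fun=> 0) fs i u.
Proof.
elim: fs U => [|f fs IHfs] U.
  have [[u Uu]|U0] := pselect (exists u, U u).
    exists [:: u] => [v|w _]; first by rewrite inE => /eqP ->.
    by exists u; rewrite ?inE.
  by exists [::] => // u Uu; case: U0; exists u.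
have [s0 s0U s0P] := IHfs U.
(* [s0] dominates every [u] with [f u] at least the maximum of [f] on [s0]. Below it, [f] takes
   finitely many values, and the induction hypothesis applies to each level set. *)
have [s sU sP] : exists2 s : seq T, (forall v, v \in s -> U v) &
    forall u, U u -> f u < \max_(v <- s0) f v ->
      exists2 v, v \in s & forall i, i < (size fs).+1 ->
        nth (fun=> 0) (f :: fs) i v <= nth (fun=> 0) (f :: fs) i u.
  elim: (\max_(v <- s0) f v) => [|M [s sU sP]]; first by exists [::].
  have [s1 s1U s1P] := IHfs (fun u => U u /\ f u = M).
  exists (s1 ++ s) => [v|u Uu].
    by rewrite mem_cat => /orP[/s1U[]|/sU].
  rewrite ltnS leq_eqVlt => /orP[/eqP fu|/(sP u Uu)[v vs vP]]; last first.
    by exists v; rewrite // mem_cat vs orbT.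
  have [v vs vP] := s1P u (conj Uu fu); exists v; first by rewrite mem_cat vs.
  by case=> [_ /=|]; [have [_ ->] := s1U v vs; rewrite fu | exact: vP].
exists (s0 ++ s) => [v|u Uu]; first by rewrite mem_cat => /orP[/s0U|/sU].
have [fu|fu] := ltnP (f u) (\max_(v <- s0) f v).
  by have [v vs vP] := sP u Uu fu; exists v; rewrite // mem_cat vs orbT.
have [v vs vP] := s0P u Uu; exists v; first by rewrite mem_cat vs.
case=> [_ /=|]; last exact: vP.
by apply: leq_trans fu; exact: leq_bigmax_seq.
Qed.

(** * Antitone sequences and finite determination *)

Section Monotone.
Context {disp : Order.disp_t} {L : latticeType disp} {f : opseq L}.
Hypotheses (f3 : HC3 f) (f4 : HC4 f).

Lemma opseq_perm n (s t : n.+1.-tuple L) : perm_eq s t -> f s = f t.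
Proof.
move=> /tuple_permP[p sE]; rewrite (f4 t p); congr (f _); exact: val_inj.
Qed.

(** (HC4) brings the entries of [s] to the front one by one, where (HC3) omits them. *)
Lemma opseq_cat n m (t : n.+1.-tuple L) (s : seq L) (u : m.+1.-tuple L) :
  perm_eq u (s ++ t) -> (f u <= f t)%O.
Proof.
elim: s m u => [|a s IHs] m u ust.
  have mn : m = n by have := perm_size ust; rewrite !size_tuple => -[].
  by subst m; rewrite (opseq_perm ust).
have st : size (s ++ t) == m.
  by have := perm_size ust; rewrite /= !size_tuple => -[->].
case: m st => [|m] st in u ust *.
  by move: st; rewrite size_cat size_tuple addnS.
rewrite (@opseq_perm _ u (cons_tuple a (Tuple st))) //.
by apply: le_trans (f3 _ _) (IHs _ _ _).
Qed.

Lemma opseq_count n m (t : n.+1.-tuple L) (u : m.+1.-tuple L) :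
  (forall x, count_mem x t <= count_mem x u) -> (f u <= f t)%O.
Proof.
move=> /count_subseqP[s /perm_to_subseq[r urs] ts].
apply: (@opseq_cat _ _ _ r); apply: perm_trans urs _.
by rewrite perm_catC perm_cat2l perm_sym.
Qed.

End Monotone.

Lemma finitely_determined (disp : Order.disp_t) (L : latticeType disp)
    (f : opseq L) :
  finite_set [set: L]%classic -> HC3 f -> HC4 f ->
  exists Phi : set (comm_eq L), finite_set Phi /\
    is_largest
      (fun g : opseq L =>
         [/\ HC3 g, HC4 g & forall e, Phi e -> satisfies g e])
      f.
Proof.
move=> /finite_seqP[els elsE] f3 f4.
have in_els x : x \in els by have : [set: L]%classic x by []; rewrite elsE.
pose T := {n : nat & n.+1.-tuple L}.
pose val_f (t : T) := f (tag t) (tagged t).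
(* The second half of fs forces the dominated tuple to have the same value. *)
pose fs := [seq (fun t : T => count_mem x (tagged t)) | x <- els] ++
  [seq (fun t : T => nat_of_bool (val_f t != x)) | x <- els].
have [s _ sP] := dickson fs (fun=> True).
exists ((fun t : T => CommEq (tagged t) (val_f t)) @` [set` s])%classic.
split; first exact/finite_image/finite_seq.
split; first by split=> // _ [t _ <-].
move=> g [g3 g4 gPhi] n u.
have [[m t] ts tP] := sP (Tagged (fun n => n.+1.-tuple L) u) I.
have cnt x : count_mem x t <= count_mem x u.
  have ix : index x els < size els by rewrite index_mem.
  have := tP (index x els).
  rewrite size_cat !size_map nth_cat size_map ix ltn_addr // => /(_ isT).
  by rewrite (nth_map x) ?nth_index.
(* In the second half of [fs], the entry for [x = f n u] is 0 at [u], hence 0 at [t]. *)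
have val_tu : f m t = f n u.
  have ix : index (f n u) els < size els by rewrite index_mem.
  have := tP (size els + index (f n u) els).
  rewrite size_cat !size_map nth_cat size_map ltn_add2l ix ltnNge leq_addr.
  move=> /(_ isT) /=; rewrite addKn !(nth_map (f n u)) // nth_index //.
  by rewrite /val_f /= eqxx; case: eqP.
(* The chain is [g u <= g t = f t = f u], with the middle equality from [Phi]. *)
rewrite -val_tu; apply: le_trans (opseq_count g3 g4 cnt) _.
have gt : satisfies g (CommEq t (f m t)).
  by apply: gPhi; eexists; first exact: ts.
by rewrite -[X in (_ <= X)%O]gt.
Qed.

Theorem theorem9p1 (S : signature) (V : algebra S -> Prop) (A : algebra S)
    (V_variety : is_variety V) (V_modular : congruence_modular V) (VA : V A)
    (fin_con : finite_set [set: con A]%classic) :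
  exists Phi : set (comm_eq (con A)),
    finite_set Phi /\
    is_largest
      (fun f : opseq (con A) =>
         [/\ HC3 f, HC4 f & forall e, Phi e -> satisfies f e])
      (hcomm A).
Proof.
apply: finitely_determined => //; first exact: hcomm_HC3 V_variety V_modular VA.
exact: hcomm_HC4 V_variety V_modular VA.
Qed.
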